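(* Let $d\ge 5$ and let $G_d=\langle A,B\rangle$ be the alternate mother group acting on the $d$-regular rooted tree $T_d$. Then the sets $L_k$, $k\ge 0$, form a Folner sequence for $G_d$ with respect to the generating set $A\cup B$, i.e. $\frac{|\partial L_k|}{|L_k|}\to 0$ as $k\to\infty$. In particular, the group $G_d$ is amenable.
   Context: $\mathcal A_d$ is the alternating group on $\{1,\dots,d\}$. $T_d$ is the $d$-regular rooted tree whose vertices are finite words over $\{1,\dots,d\}$. $Aut^{alt}(T_d)$ is the group of automorphisms of the rooted tree $T_d$ all of whose local permutations at vertices are even. There is a canonical isomorphism $\varphi:Aut^{alt}(T_d)\to Aut^{alt}(T_d)\wr\mathcal A_d=(Aut^{alt}(T_d)^d)\rtimes\mathcal A_d$, by which one identifies $g=(g_1,\dots,g_d)\sigma$ ($\sigma$ is the permutation of the first level induced by $g$ and $g_t$ is the automorphism induced from the subtree at $t$ to the subtree at $\sigma(t)$). The product is $gg'=(g_1g'_{\sigma(1)},\dots,g_dg'_{\sigma(d)})\sigma\sigma'$, where $g$ is applied before $g'$ (so $(\sigma\sigma')(t)=\sigma'(\sigma(t))$). $A=\{a(\sigma):\sigma\in\mathcal A_d\}\simeq\mathcal A_d$ is the group of rooted automorphisms $a(\sigma)=(e,\dots,e)\sigma$; one identifies $A$ with $\mathcal A_d$. For $a_2,\dots,a_d\in\mathcal A_d$ and $\rho\in\mathcal A_d$ with $\rho(1)=1$, the automorphism $b=b(a_2,\dots,a_d,\rho)$ is defined recursively by $b=(b,a_2,\dots,a_d)\rho$. $B$ is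 the set of all such $b$; it is a finite subgroup of $Aut^{alt}(T_d)$. The alternate mother group is $G_d=\langle A,B\rangle<Aut^{alt}(T_d)$. For $d\ge5$, $\varphi$ restricts to an isomorphism $G_d\simeq G_d\wr\mathcal A_d$. For $L\subset G_d$, the boundary is $\partial L=\{\gamma\in L:\exists s\in A\cup B,\ \gamma s\notin L\}$ and the interior is $Int(L)=L\setminus\partial L$. The sets $L_k\subset G_d$ are defined by $L_0=\{g\in G_d:\ g=(\beta,\alpha_2,\dots,\alpha_d)\sigma \text{ for some }\beta\in B,\ \alpha_2,\dots,\alpha_d,\sigma\in A\}$ and, inductively, $L_{k+1}=\{g=(g_1,\dots,g_d)\sigma\in G_d:\ \sigma\in A,\ g_t\in L_k\ \forall t\in\{1,\dots,d\},\text{ and } g_T\in Int(L_k)\text{ for some }T\in\{1,\dots,d\}\}$. *)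

(* Defs.v *)
From HB Require Import structures.
From mathcomp Require Import all_boot all_order all_algebra.
From mathcomp Require Import fingroup perm alt.
From mathcomp Require Import finmap.
From mathcomp Require Import mathcomp_extra boolp classical_sets functions.
From mathcomp Require Import cardinality reals topology normedtype sequences.

Set Implicit Arguments.
Unset Strict Implicit.
Unset Printing Implicit Defensive.

Import Order.TTheory GRing.Theory Num.Theory.
Import numFieldNormedType.Exports.

Local Open Scope classical_set_scope.
Local Open Scope group_scope.

(* The letters 1, ..., d of the usual notation are 0, ..., d-1 in 'I_d; in
   particular the distinguished letter 1 is the element of value 0. The
   children of the vertex u are the words rcons u x. *)
Notation word d := (seq 'I_d).

Definition tree_adj d (u v : word d) : bool :=
  [exists x, v == rcons u x] || [exists x, u == rcons v x].

Definition tree_automorphism d (f : word d -> word d) : Prop :=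
  [/\ bijective f, f [::] = [::] & forall u v, tree_adj (f u) (f v) = tree_adj u v].

Definition even_local_perms d (f : word d -> word d) : Prop :=
  forall u, exists2 s : 'S_d, s \in 'Alt_('I_d) &
    forall x, f (rcons u x) = rcons (f u) (s x).

Definition alt_aut_pred d : pred (word d -> word d) :=
  fun f => `[< tree_automorphism f /\ even_local_perms f >].

Record altAut d := AltAut {
  alt_aut_fun :> word d -> word d;
  alt_aut_funP : alt_aut_pred alt_aut_fun }.

HB.instance Definition _ d := [isSub for @alt_aut_fun d].
HB.instance Definition _ d := [Choice of altAut d by <:].

Lemma altAut_ext d (f g : altAut d) : f =1 g -> f = g.
Proof. by move=> fg; apply: val_inj; apply/funext. Qed.

Lemma altAut_localP d (f : altAut d) : even_local_perms f.
Proof. by case: f => f /= /asboolP[]. Qed.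

Lemma altAut_autP d (f : altAut d) : tree_automorphism f.
Proof. by case: f => f /= /asboolP[]. Qed.

Lemma alt_aut_predI d (f : word d -> word d) :
  f [::] = [::] -> even_local_perms f -> alt_aut_pred f.
Proof.
move=> f0 fl; have fsz u : size (f u) = size u.
  elim/last_ind: u => [|u x IH]; first by rewrite f0.
  by have [s _ ->] := fl u; rewrite !size_rcons IH.
have finj : injective f.
  elim/last_ind => [|u x IH] v.
    by move=> /(congr1 size); rewrite !fsz => /esym/size0nil ->.
  elim/last_ind: v => [|v y _].
    by move=> /(congr1 size); rewrite !fsz size_rcons.
  have [s _ su] := fl u; have [t _ tv] := fl v.
  rewrite su tv => /rcons_inj[/IH uv]; subst v.
  by move: (su y); rewrite tv => /rcons_inj[-> /perm_inj ->].
have fsur v : exists u, f u = v.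
  elim/last_ind: v => [|v y [u <-]]; first by exists [::].
  by have [s _ su] := fl u; exists (rcons u (s^-1 y)); rewrite su permKV.
have fchild u v : [exists x, f v == rcons (f u) x] = [exists x, v == rcons u x].
  have [s _ su] := fl u; apply/existsP/existsP => -[x /eqP xE].
    by exists (s^-1 x); apply/eqP/finj; rewrite xE su permKV.
  by exists (s x); rewrite xE su.
apply/asboolP; split=> //; split=> //.
- have [g gE] := choice fsur.
  by exists g => // u; apply: finj; rewrite gE.
- by move=> u v; rewrite /tree_adj !fchild.
Qed.

Lemma alt_aut_one d : @alt_aut_pred d id.
Proof.
by apply: alt_aut_predI => // u; exists 1 => [|x]; rewrite ?group1 ?perm1.
Qed.

Lemma alt_aut_comp d (f g : altAut d) : alt_aut_pred (g \o f).
Proof.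
apply: alt_aut_predI => [|u] /=.
  by have [_ -> _] := altAut_autP f; have [_ -> _] := altAut_autP g.
have [s sA su] := altAut_localP f u; have [t tA tu] := altAut_localP g (f u).
by exists (s * t) => [|x]; rewrite ?groupM // su tu permM.
Qed.

Lemma altAut_inv_subproof d (f : altAut d) :
  {g : word d -> word d | alt_aut_pred g /\ (cancel f g /\ cancel g f)}.
Proof.
apply: cid; have [[g fK gK] f0 _] := altAut_autP f.
exists g; split=> //; apply: alt_aut_predI => [|v]; first by rewrite -[in LHS]f0 fK.
have [s sA su] := altAut_localP f (g v); exists s^-1 => [|x]; first by rewrite groupV.
by apply: (can_inj fK); rewrite gK su permKV gK.
Qed.

Definition altAut1 d : altAut d := AltAut (@alt_aut_one d).

(* In f * g, the automorphism f is applied first. *)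
Definition altAutM d (f g : altAut d) : altAut d := AltAut (alt_aut_comp f g).

Definition altAutV d (f : altAut d) : altAut d :=
  AltAut (proj1 (proj2_sig (altAut_inv_subproof f))).

Lemma altAutMA d : associative (@altAutM d).
Proof. by move=> f g h; apply: altAut_ext. Qed.

Lemma altAut1M d : left_id (@altAut1 d) (@altAutM d).
Proof. by move=> f; apply: altAut_ext. Qed.

Lemma altAutM1 d : right_id (@altAut1 d) (@altAutM d).
Proof. by move=> f; apply: altAut_ext. Qed.

Lemma altAutVM d : left_inverse (@altAut1 d) (@altAutV d) (@altAutM d).
Proof.
move=> f; apply: altAut_ext => u /=.
by case: altAut_inv_subproof => g [/= ? []].
Qed.

Lemma altAutMV d : right_inverse (@altAut1 d) (@altAutV d) (@altAutM d).
Proof.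
move=> f; apply: altAut_ext => u /=.
by case: altAut_inv_subproof => g [/= ? []].
Qed.

HB.instance Definition _ d := isGroup.Build (altAut d)
  (@altAutMA d) (@altAut1M d) (@altAutM1 d) (@altAutVM d) (@altAutMV d).

Notation alt_perm d := (subg_of ('Alt_('I_d))%G).

(* g = (gs_1, ..., gs_d) s under the isomorphism of Aut^alt(T_d) with its
   permutational wreath product by the alternating group. *)
Definition wreath d (g : altAut d) (gs : 'I_d -> altAut d) (s : alt_perm d) :
    Prop :=
  forall (t : 'I_d) (w : word d), g (t :: w) = sgval s t :: gs t w.

Definition rooted_fun d (s : alt_perm d) (w : word d) : word d :=
  if w is t :: w' then sgval s t :: w' else [::].

Lemma rooted_funP d (s : alt_perm d) : alt_aut_pred (rooted_fun s).
Proof.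
apply: alt_aut_predI => // -[|t w].
  by exists (sgval s) => [|x]; rewrite ?subgP.
by exists 1 => [|x]; rewrite ?group1 ?perm1.
Qed.

Definition rooted d (s : alt_perm d) : altAut d := AltAut (rooted_funP s).

(* b = (b, a_2, ..., a_d) rho; the family a is indexed by all of 'I_d, but its
   value at the first letter is irrelevant. *)
Fixpoint directed_fun d (a : 'I_d -> alt_perm d) (rho : alt_perm d)
    (w : word d) : word d :=
  if w is t :: w' then
    sgval rho t ::
      (if val t == 0%N then directed_fun a rho w' else rooted (a t) w')
  else [::].

Lemma directed_funP d (a : 'I_d -> alt_perm d) (rho : alt_perm d) :
  alt_aut_pred (directed_fun a rho).
Proof.
apply: alt_aut_predI => // u; elim: u => [|t w [s sA sw]] /=.
  exists (sgval rho) => [|x]; rewrite ?subgP //=.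
  by case: ifP.
case: ifP => _; first by exists s => // x; rewrite sw.
by have [r rA rw] := altAut_localP (rooted (a t)) w; exists r => // x; rewrite -rw.
Qed.

Definition directed d (a : 'I_d -> alt_perm d) (rho : alt_perm d) : altAut d :=
  AltAut (directed_funP a rho).

Definition A (d : nat) : set (altAut d) := range (@rooted d).

Arguments A : clear implicits.

Definition B d : set (altAut d) :=
  [set g | exists (a : 'I_d -> alt_perm d) (rho : alt_perm d),
     (forall t : 'I_d, val t = 0%N -> sgval rho t = t) /\ g = directed a rho].

Arguments B : clear implicits.

Definition is_subgroup (gT : groupType) (H : set gT) : Prop :=
  [/\ H 1, forall x y, H x -> H y -> H (x * y) & forall x, H x -> H x^-1].

Definition generated (gT : groupType) (S : set gT) : set gT :=
  smallest (@is_subgroup gT) S.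

Definition mother_group d : set (altAut d) := generated (A d `|` B d).

Arguments mother_group : clear implicits.

Definition boundary (gT : groupType) (S L : set gT) : set gT :=
  [set g | L g /\ exists2 s, S s & ~ L (g * s)].

Definition Int (gT : groupType) (S L : set gT) : set gT := L `\` boundary S L.

Fixpoint Lset (d k : nat) : set (altAut d) :=
  if k is k'.+1 then
    [set g | mother_group d g /\ exists (gs : 'I_d -> altAut d) (s : alt_perm d),
       [/\ wreath g gs s, forall t, @Lset d k' (gs t)
         & exists T, Int (A d `|` B d) (@Lset d k') (gs T)]]
  else
    [set g | mother_group d g /\ exists (gs : 'I_d -> altAut d) (s : alt_perm d),
       wreath g gs s /\
       forall t : 'I_d, if val t == 0%N then B d (gs t) else A d (gs t)].

Arguments Lset : clear implicits.

(* fset_set and division by 0 are total, hence the finiteness and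
   nonemptiness clauses. *)
Definition folner_sequence (R : realType) (gT : groupType) (G S : set gT)
    (L : nat -> set gT) : Prop :=
  (forall k, [/\ L k `<=` G, finite_set (L k) & L k !=set0]) /\
  (fun k => (#|` fset_set (boundary S (L k))|%:R
             / #|` fset_set (L k)|%:R)%R : R) @ \oo --> (0%R : R).

(* Existence of a left-invariant finitely additive probability measure on all
   subsets of the group G. *)
Definition amenable (R : realType) (gT : groupType) (G : set gT) : Prop :=
  exists m : set gT -> R,
    [/\ forall E, E `<=` G -> (0 <= m E)%R,
        m G = 1%R,
        forall E F, E `<=` G -> F `<=` G -> E `&` F = set0 ->
          m (E `|` F) = (m E + m F)%R
      & forall g E, G g -> E `<=` G -> m [set g * x | x in E] = m E].

(* Main.v *)
From mathcomp Require Import all_boot all_order all_algebra.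
From mathcomp Require Import fingroup perm alt.
From mathcomp Require Import commutator gseries maximal nilpotent.
From mathcomp Require Import finmap.
From mathcomp Require Import boolp classical_sets functions.
From mathcomp Require Import ring lra.
From mathcomp Require Import cardinality reals topology normedtype sequences.
From mathcomp Require Import realfun.
Require Import Defs.

(* Write g = (g_1, ..., g_d) s. Since A_d is perfect for d >= 5, commutators of
   conjugates of directed automorphisms give all (1, ..., a, ..., 1) with a
   rooted, and then all (g_1, ..., g_d) s with every g_t in G_d lie in G_d, so
   L_{k+1} can be counted freely:
     |L_{k+1}| = |A_d| (|L_k|^d - |bd L_k|^d).
   Moreover g is interior in L_{k+1} as soon as its components lie in L_k and
   the one sent to the distinguished letter is interior in L_k. Hence
   u_k = |bd L_k| / |L_k| satisfies 1 - u_k <= (1 - u_{k+1}) (1 - u_k^d); it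
   decreases to a limit l < 1 with 1 - l <= (1 - l) (1 - l^d), so l = 0. *)

Set Implicit Arguments.
Unset Strict Implicit.
Unset Printing Implicit Defensive.

Import Order.TTheory GRing.Theory Num.Theory.
Import numFieldNormedType.Exports.

Local Open Scope classical_set_scope.
Local Open Scope group_scope.

(** * Components and products in the wreath recursion *)

Definition glue_fun d (gs : 'I_d -> altAut d) (s : alt_perm d) (w : word d) :
    word d :=
  if w is t :: w' then sgval s t :: gs t w' else [::].

Lemma glue_funP d (gs : 'I_d -> altAut d) (s : alt_perm d) :
  alt_aut_pred (glue_fun gs s).
Proof.
apply: alt_aut_predI => // -[|t w].
  exists (sgval s) => [|x]; rewrite ?subgP //=.
  by have [_ -> _] := altAut_autP (gs x).
by have [r rA rw] := altAut_localP (gs t) w; exists r => //= x; rewrite rw.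
Qed.

Definition glue d (gs : 'I_d -> altAut d) (s : alt_perm d) : altAut d :=
  AltAut (glue_funP gs s).

(** [glue] inverts the wreath isomorphism: components and first-level permutation determine the
    action on nonempty words, so [wreath] becomes an equation. *)
Lemma wreath_glueP d (g : altAut d) (gs : 'I_d -> altAut d) (s : alt_perm d) :
  wreath g gs s <-> g = glue gs s.
Proof.
split=> [gE|-> //]; apply: altAut_ext => -[|t w] /=; last exact: gE.
by have [_ -> _] := altAut_autP g.
Qed.

Lemma glue_inj d (gs hs : 'I_d -> altAut d) (s t : alt_perm d) :
  glue gs s = glue hs t -> gs = hs /\ s = t.
Proof.
move=> /(congr1 (@alt_aut_fun d)) /= E; split.
  apply/funext => x; apply: altAut_ext => w.
  by have := congr1 (@^~ (x :: w)) E => -[].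
by apply/val_inj/permP => x; have := congr1 (@^~ [:: x]) E => -[].
Qed.

Lemma glueM d (gs hs : 'I_d -> altAut d) (s t : alt_perm d) :
  glue gs s * glue hs t = glue (fun i => gs i * hs (sgval s i)) (s * t).
Proof. by apply: altAut_ext => -[|x w] //=; rewrite permM. Qed.

Lemma glue1 d : glue (fun=> 1) 1 = 1 :> altAut d.
Proof. by apply: altAut_ext => -[|x w] //=; rewrite perm1. Qed.

Lemma rooted_glue d (s : alt_perm d) : rooted s = glue (fun=> 1) s.
Proof. by apply: altAut_ext => -[]. Qed.

Lemma glue_rooted d (gs : 'I_d -> altAut d) (s t : alt_perm d) :
  glue gs s * rooted t = glue gs (s * t).
Proof.
by rewrite rooted_glue glueM; congr glue; apply/funext => i; rewrite mulg1.
Qed.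

Lemma rootedM d (s t : alt_perm d) : rooted s * rooted t = rooted (s * t).
Proof. by rewrite [rooted s]rooted_glue glue_rooted rooted_glue. Qed.

Lemma rooted1 d : rooted 1 = 1 :> altAut d.
Proof. by rewrite rooted_glue glue1. Qed.

Lemma rootedV d (s : alt_perm d) : (rooted s)^-1 = rooted s^-1.
Proof. by rewrite -[RHS](mulKg (rooted s)) rootedM mulgV rooted1 mulg1. Qed.

Lemma directed_glue d (a : 'I_d -> alt_perm d) (rho : alt_perm d) :
  directed a rho =
  glue (fun t => if val t == 0%N then directed a rho else rooted (a t)) rho.
Proof. by apply: altAut_ext => -[|t w] //=; case: ifP. Qed.

(** As [r] fixes the distinguished letter and sends no other letter there, the recursive component
    of the product is again the product; this makes [B] closed under products. *)
Lemma directedM d (a b : 'I_d -> alt_perm d) (r s : alt_perm d) :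
  (forall t : 'I_d, val t = 0%N -> sgval r t = t) ->
  directed a r * directed b s = directed (fun t => a t * b (sgval r t)) (r * s).
Proof.
move=> r0; apply: altAut_ext; elim=> // t w IHw.
rewrite /= permM; case: (val t =P 0%N) => [t0|t0].
  by rewrite r0 // t0 eqxx; congr (_ :: _); exact: IHw.
case: eqP => [rt0|_]; last first.
  congr (_ :: _); have := rootedM (a t) (b (sgval r t)).
  by move=> /(congr1 (fun g : altAut d => g w)).
by case: t0; have := r0 _ rt0 => /perm_inj <-.
Qed.

Lemma glue_conj d (gs : 'I_d -> altAut d) (s : alt_perm d) :
  glue (gs \o sgval s) 1 = rooted s * glue gs 1 * (rooted s)^-1.
Proof.
rewrite rootedV rooted_glue glueM glue_rooted mulg1 mulgV.
by congr glue; apply/funext => i /=; rewrite mul1g.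
Qed.

Lemma glue1M d (gs hs : 'I_d -> altAut d) :
  glue gs 1 * glue hs 1 = glue (fun i => gs i * hs i) 1.
Proof.
by rewrite glueM mulg1; congr glue; apply/funext => i; rewrite perm1.
Qed.

Lemma glue1V d (gs : 'I_d -> altAut d) :
  (glue gs 1)^-1 = glue (fun i => (gs i)^-1) 1.
Proof.
rewrite -[RHS](mulKg (glue gs 1)) glue1M.
rewrite (_ : (fun _ => _) = fun=> 1) ?glue1 ?mulg1 //.
by apply/funext => i; rewrite mulgV.
Qed.

Lemma glue1R d (gs hs : 'I_d -> altAut d) :
  [~ glue gs 1, glue hs 1] = glue (fun i => [~ gs i, hs i]) 1.
Proof. by rewrite /commg /conjg !(glue1V, glue1M). Qed.

Definition single d (t : 'I_d) (g : altAut d) : altAut d :=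
  glue (fun i => if i == t then g else 1) 1.

Lemma singleM d (t : 'I_d) (g h : altAut d) :
  single t g * single t h = single t (g * h).
Proof.
rewrite glue1M; congr glue; apply/funext => i.
by case: eqP => _; rewrite ?mulg1.
Qed.

Lemma single1 d (t : 'I_d) : single t 1 = 1.
Proof.
by rewrite -[RHS]glue1; congr glue; apply/funext => i; rewrite if_same.
Qed.

Lemma singleV d (t : 'I_d) (g : altAut d) : (single t g)^-1 = single t g^-1.
Proof.
rewrite glue1V; congr glue; apply/funext => i.
by case: eqP => _; rewrite ?invg1.
Qed.

(** * Perfectness and transitivity of the alternating group *)

Lemma Alt_perfect (T : finType) : 5 <= #|T| -> ('Alt_T)^`(1) = 'Alt_T.
Proof.
move=> T5; have /simpleP[_ sA] := simple_Alt5 T5.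
(* By simplicity the derived subgroup is trivial or everything. If trivial, the group has prime
   order; but 24 divides |T|!, twice that order, so 2 and 3 would both equal this prime. *)
have [|//] := sA _ (der_normal 1 ('Alt_T)%G).
move=> /derG1P cA.
have := simple_sol_prime (abelian_sol cA) (simple_Alt5 T5).
have: 12 %| #|'Alt_T|.
  rewrite -(@dvdn_pmul2l 2) // card_Alt ?(leq_trans _ T5) //.
  by rewrite (fact_split (ltnW T5)) dvdn_mulr.
move=> d12 pA.
have := dvdn_trans (isT : 2 %| 12) d12.
rewrite (dvdn_prime2 _ pA) // => /eqP E2.
by have := dvdn_trans (isT : 3 %| 12) d12; rewrite -E2.
Qed.

Lemma generated_is_subgroup (gT : groupType) (S : set gT) :
  is_subgroup (generated S).
Proof.
split=> [H [[H1 _ _] _] // | x y Gx Gy H HS | x Gx H HS].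
  by have [[_ HM _] _] := HS; apply: HM; [exact: Gx | exact: Gy].
by have [[_ _ HV] _] := HS; apply: HV; exact: Gx.
Qed.

Lemma alt_transitive d (x y : 'I_d) : 3 <= d ->
  exists s : alt_perm d, sgval s x = y.
Proof.
move=> d3; have [<-|nxy] := eqVneq x y; first by exists 1; rewrite perm1.
have [u nu] : exists u : 'I_d, u \notin [set x; y]%SET.
  apply/existsP; rewrite -negb_forall; apply/negP => /forallP xyT.
  have /subset_leq_card : 'I_d \subset [set x; y]%SET.
    by apply/fintype.subsetP => z _; exact: xyT.
  by rewrite card_ord cards2 nxy leqNgt d3.
move: nu; rewrite !inE negb_or => /andP[nux nuy].
(* The first factor sends x to y; the second makes the product even and fixes y. *)
have sA : tperm x y * tperm x u \in 'Alt_('I_d).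
  by rewrite Alt_even odd_permM !odd_tperm nxy eq_sym nux.
by exists (Subg sA); rewrite /= permM tpermL tpermD // 1?eq_sym.
Qed.

(** * The mother group contains its full wreath product *)

Section MotherGroup.
Variables (d : nat).
Hypothesis hd : 5 <= d.

Notation G := (mother_group d).

Lemma mother1 : G 1.
Proof. by have [] := generated_is_subgroup (A d `|` B d). Qed.

Lemma motherM x y : G x -> G y -> G (x * y).
Proof. by have [_ + _] := generated_is_subgroup (A d `|` B d); apply. Qed.

Lemma motherV x : G x -> G x^-1.
Proof. by have [_ _] := generated_is_subgroup (A d `|` B d); apply. Qed.

Lemma mother_rooted s : G (rooted s).
Proof. by apply: sub_gen_smallest; left; exists s. Qed.

Lemma mother_B g : B d g -> G g.
Proof. by move=> Bg; apply: sub_gen_smallest; right. Qed.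

Lemma mother_conj (gs : 'I_d -> altAut d) (s : alt_perm d) :
  G (glue gs 1) -> G (glue (gs \o sgval s) 1).
Proof.
by move=> Gg; rewrite glue_conj; do !apply: motherM => //;
  rewrite ?rootedV; exact: mother_rooted.
Qed.

(** Conjugation by a rooted automorphism permutes the components, and even permutations are
    transitive on letters, so one convenient letter suffices. *)
Lemma mother_single_move (x y : 'I_d) g : G (single x g) -> G (single y g).
Proof.
have [s sxy] := alt_transitive y x (leq_trans (isT : 3 <= 5) hd).
move=> /(@mother_conj _ s); congr (G (glue _ _)).
by apply/funext => i /=; rewrite -sxy (inj_eq perm_inj).
Qed.

(* Two directed automorphisms, whose only nontrivial rooted component sits at
   the letter i1, are moved apart at the distinguished letter by an even
   permutation fixing i1; their commutator is then supported at i1. *)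
Lemma mother_single_commg (t : 'I_d) (a b : alt_perm d) :
  G (single t (rooted [~ a, b])).
Proof.
pose i k (kd : k < 5) : 'I_d := Ordinal (leq_trans kd hd).
pose i0 := i 0%N isT; pose i1 := i 1%N isT; pose i2 := i 2%N isT.
pose i3 := i 3%N isT; pose i4 := i 4%N isT.
apply: (@mother_single_move i1).
pose h c : altAut d := directed (fun t => if t == i1 then c else 1) 1.
pose f c t : altAut d :=
  if t == i0 then h c else if t == i1 then rooted c else 1.
have hE c : h c = glue (f c) 1.
  rewrite /h directed_glue; congr glue; apply/funext => u.
  rewrite /f (_ : (u == i0) = (val u == 0%N)) //; case: ifP => // _.
  by case: (u == i1); rewrite ?rooted1.
have Gf c : G (glue (f c) 1).
  rewrite -hE; apply: mother_B.
  by exists (fun t => if t == i1 then c else 1), 1;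
    split=> // u _; rewrite perm1.
(* [tperm i3 i4] repairs the parity; five letters leave room for it away from [i0], [i1], [i2]. *)
have sA : tperm i0 i2 * tperm i3 i4 \in 'Alt_('I_d).
  by rewrite Alt_even ?odd_permM !odd_tperm.
pose s : alt_perm d := Subg sA.
have := motherM (motherV (Gf a)) (motherM (motherV (mother_conj s (Gf b)))
  (motherM (Gf a) (mother_conj s (Gf b)))).
rewrite -/(_ ^ _) -/[~ _, _] glue1R; congr (G (glue _ _)).
apply/funext => u /=.
have [->|n1] := eqVneq u i1.
  rewrite /f /= permM !tpermD //= /commg /conjg.
  by rewrite !(rootedV, rootedM).
have [->|n0] := eqVneq u i0.
  by rewrite /f /= permM tpermL tpermD //= commg1.
by rewrite [f a u]/f (negPf n0) (negPf n1) comm1g.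
Qed.

(** The permutations that work form a subgroup [K] containing all commutators, hence everything by
    perfectness. *)
Lemma mother_single_rooted (t : 'I_d) (s : alt_perm d) :
  G (single t (rooted s)).
Proof.
pose K := [set x : 'S_d | x \in 'Alt_('I_d) &
  `[< G (single t (rooted (subg ('Alt_('I_d))%G x))) >]]%SET.
have gK : group_set K.
  apply/group_setP; split=> [|x y].
    rewrite inE group1 /=; apply/asboolP.
    rewrite (_ : subg _ 1 = 1) ?rooted1 ?single1; first exact: mother1.
    by apply: val_inj; rewrite /= subgK ?group1.
  rewrite inE => /andP[xA /asboolP Gx]; rewrite inE => /andP[yA /asboolP Gy].
  rewrite inE groupM //=.
  by apply/asboolP; rewrite subgM // -rootedM -singleM; exact: motherM.
suff /fintype.subsetP/(_ _ (subgP s)) : 'Alt_('I_d) \subset (Group gK).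
  by rewrite inE subgP /= => /asboolP; rewrite sgvalK.
rewrite -{1}Alt_perfect ?card_ord // dergSn gen_subG.
apply/fintype.subsetP => _ /imset2P[x y xA yA ->].
rewrite inE groupR //=; apply/asboolP.
rewrite (_ : subg _ _ = [~ subg _ x, subg _ y]).
  exact: mother_single_commg.
by apply: val_inj; rewrite /commg /conjg /= !subgK ?(groupM, groupV).
Qed.

Lemma mother_glue_single (gs : 'I_d -> altAut d) (s : alt_perm d) :
  (forall t, G (single t (gs t))) -> G (glue gs s).
Proof.
move=> Gs; rewrite -[s]mul1g -glue_rooted; apply: motherM (mother_rooted s).
(* Components are filled in letter by letter; without repetitions each enters once. *)
suff Gr r : uniq r -> G (glue (fun i => if i \in r then gs i else 1) 1).
  have := Gr _ (enum_uniq 'I_d); congr (G (glue _ _)).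
  by apply/funext => i; rewrite mem_enum.
elim: r => [_|x r IHr /= /andP[xr ur]]; first by rewrite glue1; exact: mother1.
have := motherM (Gs x) (IHr ur); rewrite glue1M; congr (G (glue _ _)).
apply/funext => i; rewrite inE; case: eqP => [->|_ /=]; last by rewrite mul1g.
by rewrite (negPf xr) mulg1.
Qed.

Lemma mother_single (t : 'I_d) g : G g -> G (single t g).
Proof.
move: g; apply: smallest_sub.
  split=> [|x y Gx Gy|x Gx]; first by rewrite /= single1; exact: mother1.
    by rewrite /= -singleM; exact: motherM.
  by rewrite /= -singleV; exact: motherV.
move=> _ [[s _ <-]|[a [r [r0 ->]]]]; first exact: mother_single_rooted.
pose i0 : 'I_d := Ordinal (leq_trans (isT : 0 < 5) hd).
apply: (@mother_single_move i0).
(* Cancelling the first-level permutation and the rooted components [a u] of a directed generator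
   leaves the generator alone, at the distinguished letter. *)
pose h (u : 'I_d) : altAut d := if val u == 0%N then 1 else rooted (a u).
have Gh : G (glue h 1).
  apply: mother_glue_single => u; rewrite /h; case: ifP => _.
    by rewrite single1; exact: mother1.
  exact: mother_single_rooted.
have Gb : G (directed a r) by apply: mother_B; exists a, r.
have := motherM (motherM Gb (mother_rooted r^-1)) (motherV Gh).
rewrite directed_glue glue_rooted mulgV glue1V glue1M; congr (G (glue _ _)).
apply/funext => u; rewrite /h (_ : (u == i0) = (val u == 0%N)) //.
case: ifP => _; last by rewrite mulgV.
by rewrite invg1 mulg1 [LHS]directed_glue.
Qed.

Lemma mother_glue (gs : 'I_d -> altAut d) (s : alt_perm d) :
  (forall t, G (gs t)) -> G (glue gs s).
Proof.
by move=> Gs; apply: mother_glue_single => t; apply: mother_single; exact: Gs.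
Qed.

End MotherGroup.

(** * Cardinalities of images, interiors and boundaries *)

Lemma card_fset_set_image (T : finType) (K : choiceType) (f : T -> K)
    (P : pred T) :
  injective f -> #|` fset_set (f @` [set` P])| = #|P|.
Proof.
move=> fI; have -> : fset_set (f @` [set` P]) = seq_fset tt (map f (enum P)).
  apply/fsetP => x; rewrite seq_fsetE in_fset_set; last first.
    exact/finite_image/finite_finset.
  apply/idP/mapP => [/set_mem[t Pt <-]|[t tP ->]].
    by exists t; rewrite ?mem_enum.
  by apply/mem_set; exists t; rewrite // mem_enum in tP.
by rewrite size_seq_fset undup_id ?map_inj_uniq ?enum_uniq // size_map cardE.
Qed.

Lemma leq_card_fset_set_sub (K : choiceType) (X Y : set K) :
  finite_set Y -> X `<=` Y -> #|` fset_set X| <= #|` fset_set Y|.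
Proof.
move=> fY XY; have fX := sub_finite_set XY fY.
by apply: fsubset_leq_card; rewrite -fset_set_sub.
Qed.

Lemma IntP (gT : groupType) (S L : set gT) (g : gT) :
  Int S L g <-> L g /\ forall x, S x -> L (g * x).
Proof.
split=> [[Lg nB]|[Lg LS]]; split=> //.
  by move=> x Sx; apply: contrapT => nL; apply: nB; split=> //; exists x.
by move=> [_ [x Sx]]; apply; exact: LS.
Qed.

Lemma card_boundary_Int (gT : groupType) (S L : set gT) : finite_set L ->
  (#|` fset_set (boundary S L)| + #|` fset_set (Int S L)| = #|` fset_set L|)%N.
Proof.
move=> fL; have bL : boundary S L `<=` L by move=> x [].
have fb := sub_finite_set bL fL.
have sub : (fset_set (boundary S L) `<=` fset_set L)%fset.
  by rewrite -fset_set_sub.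
rewrite /Int fset_setD // cardfsD (fsetIidPr sub) subnKC //.
exact: fsubset_leq_card.
Qed.

(** * Counting one step of the recursion *)

Section Step.
Variables (d : nat) (L : set (altAut d)).
Hypothesis d_gt0 : 0 < d.
Hypothesis LA : forall g s, L g -> L (g * rooted s).

Notation S := (A d `|` B d).
Notation i0 := (Ordinal d_gt0).

(** The passage from L_k to L_{k+1} for an abstract [L]; membership in the mother group is settled
    in [LsetS]. *)
Definition step : set (altAut d) := [set g | exists (gs : 'I_d -> altAut d) s,
  [/\ g = glue gs s, forall t, L (gs t) & exists T, Int S L (gs T)]].

Lemma B_mul (g h : altAut d) : B d g -> B d h -> B d (g * h).
Proof.
move=> [a [r [r0 ->]]] [b [s [s0 ->]]]; rewrite directedM //.
by do 2!eexists; split; last by []; move=> t t0; rewrite /= permM r0 // s0.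
Qed.

(** Two translations by [B] amount to one, and [L] absorbs rooted ones, so interior points survive
    translation by [B]. *)
Lemma Int_mulB (g b : altAut d) : Int S L g -> B d b -> Int S L (g * b).
Proof.
move=> /IntP[Lg LS] Bb; have Lgb : L (g * b) by apply: LS; right.
apply/IntP; split=> // x [[s _ <-]|Bx]; first exact: LA.
by rewrite -mulgA; apply: LS; right; apply: B_mul.
Qed.

(* Right multiplication by b = (b, a_2, ..., a_d) rho multiplies by b exactly
   the component of g at the letter that g sends to the distinguished one. *)
Lemma Int_step (gs : 'I_d -> altAut d) (s : alt_perm d) :
  (forall t, L (gs t)) -> Int S L (gs ((sgval s)^-1 i0)) ->
  Int S step (glue gs s).
Proof.
set T := _ i0 => Lgs IT; apply/IntP; split.
  by exists gs, s; split=> //; exists T.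
move=> _ [[r _ <-]|[a [r [r0 ->]]]].
  by rewrite glue_rooted; exists gs, (s * r); split=> //; exists T.
have Bb : B d (directed a r) by exists a, r.
rewrite directed_glue glueM; do 2!eexists; split; first by [].
  move=> t /=; case: ifP => [/eqP st0|_]; last exact: LA.
  have -> : t = T by apply: (canRL (permK _)); exact: val_inj.
  by have /IntP[_] := IT; apply; right.
by exists T; rewrite /T permKV /=; exact: Int_mulB.
Qed.

Hypothesis finL : finite_set L.

Local Notation X := (fset_set L).
(** Finite codes, through [f], for the automorphisms with all components in [L]; [step] is the image
    of those with at least one interior component. *)
Local Notation TT := (alt_perm d * {ffun 'I_d -> X})%type.

Let f (p : TT) : altAut d := glue (fun t => val (p.2 t)) p.1.
Let I : pred X := fun x => `[< Int S L (val x) >].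

Let f_inj : injective f.
Proof.
move=> [s h] [s' h'] /glue_inj[/= hh ->]; congr pair.
by apply/ffunP => t; apply: val_inj; have := congr1 (@^~ t) hh.
Qed.

Let X_L (x : X) : L (val x).
Proof. by have := valP x; rewrite in_fset_set // => /set_mem. Qed.

Let lift_L (gs : 'I_d -> altAut d) : (forall t, L (gs t)) ->
  exists h : {ffun 'I_d -> X}, forall t, val (h t) = gs t.
Proof.
move=> Lgs; have gX t : gs t \in X by rewrite in_fset_set //; exact/mem_set.
by exists [ffun t => FSetSub (gX t)] => t; rewrite ffunE.
Qed.

Let step_image : step = f @` [set` [pred p : TT | [exists t, I (p.2 t)]]].
Proof.
apply/seteqP; split=> [_ [gs [s [-> /lift_L[h hE] [T IT]]]]|
  _ [[s h] /existsP[T /asboolP IT] <-]].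
  exists (s, h); first by apply/existsP; exists T; apply/asboolP; rewrite hE.
  by congr glue; apply/funext.
by exists (fun t => val (h t)), s; split=> //; exists T.
Qed.

Let card_I : #|I| = #|` fset_set (Int S L)|.
Proof.
rewrite -(card_fset_set_image _ val_inj); congr (#|` fset_set _|).
apply/seteqP; split=> [_ [x /asboolP Ix <-] //|g Ig].
have gX : g \in X by rewrite in_fset_set //; apply/mem_set; case: Ig.
by exists (FSetSub gX) => //; exact/asboolP.
Qed.

Let card_CI : #|[predC I]| = #|` fset_set (boundary S L)|.
Proof.
by apply: (@addIn #|I|); rewrite addnC cardC card_I card_boundary_Int // cardfE.
Qed.

Lemma finite_step : finite_set step.
Proof. by rewrite step_image; exact/finite_image/finite_finset. Qed.

(** Among all tuples of components in [L], exactly those lying entirely in the boundary are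
    excluded. *)
Lemma card_step : #|` fset_set step| =
  (#|alt_perm d| * (#|` X| ^ d - #|` fset_set (boundary S L)| ^ d))%N.
Proof.
rewrite step_image (card_fset_set_image _ f_inj).
have CE : #|[predC [pred p : TT | [exists t, I (p.2 t)]]]| =
    #|[predX (predT : pred (alt_perm d)) &
             (ffun_on [predC I] : pred {ffun 'I_d -> X})]|.
  apply: fintype.eq_card => p; rewrite !inE negb_exists.
  by apply/forallP/ffun_onP.
have := cardC [pred p : TT | [exists t, I (p.2 t)]].
rewrite CE cardX card_ffun_on card_CI card_prod card_ffun -cardfE card_ord.
by rewrite mulnBr => <-; rewrite addnK.
Qed.

Let card_single (t : 'I_d) :
  #|[pred h : {ffun 'I_d -> X} | I (h t)]| = (#|I| * #|` X| ^ d.-1)%N.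
Proof.
pose F u : pred X := if u == t then I else predT.
transitivity #|(family F : simpl_pred {ffun 'I_d -> X})|.
  apply: fintype.eq_card => h; rewrite !inE; apply/idP/familyP => [It u|/(_ t)].
    by rewrite /F; case: eqP => [->|].
  by rewrite /F eqxx.
rewrite card_family foldrE big_image (bigD1 t) //= {1}/F eqxx; congr muln.
rewrite (eq_bigr (fun=> #|` X|)); last first.
  by move=> u /negPf ut; rewrite /F ut cardfE.
rewrite prod_nat_const; congr expn.
by have := cardC1 t; rewrite card_ord.
Qed.

(** For each first-level permutation, [Int_step] constrains a single component to be interior and
    leaves the other d-1 free in [L]; this bounds the interior of [step] from below. *)
Lemma card_boundary_step :
  (#|` fset_set (boundary S step)| +
   #|alt_perm d| * ((#|` X| - #|` fset_set (boundary S L)|) * #|` X| ^ d.-1)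
   <= #|` fset_set step|)%N.
Proof.
rewrite -(card_boundary_Int S finite_step) leq_add2l.
pose T (s : alt_perm d) : 'I_d := (sgval s)^-1 i0.
pose Q : pred TT := fun p => I (p.2 (T p.1)).
have QI : f @` [set` Q] `<=` Int S step.
  move=> _ [[s h] /asboolP /= Qp <-]; exact: Int_step.
have fI : finite_set (Int S step) by apply: sub_finite_set finite_step => x [].
apply: leq_trans (leq_card_fset_set_sub fI QI).
have -> : (#|` X| - #|` fset_set (boundary S L)|)%N = #|I|.
  by rewrite -(card_boundary_Int S finL) addKn card_I.
rewrite (card_fset_set_image _ f_inj) -[leqRHS]sum1_card.
rewrite -(pair_big_dep xpredT (fun s (h : {ffun 'I_d -> X}) => I (h (T s)))
  (fun _ _ => 1%N)) /=.
rewrite (eq_bigr (fun=> (#|I| * #|` X| ^ d.-1)%N)).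
  by rewrite sum_nat_const.
by move=> s _; rewrite sum1_card card_single.
Qed.

End Step.

(** * Recursion, finiteness and nonempty interior for the sets [Lset] *)

Section Lset.
Variable d : nat.
Hypothesis hd : 5 <= d.

Notation S := (A d `|` B d).

(** The components lie in the mother group, so by [mother_glue] any automorphism glued from them
    does too. *)
Lemma LsetS k : Lset d k.+1 = step (Lset d k).
Proof.
apply/seteqP; split=> [g [_ [gs [s [/wreath_glueP -> Lgs IT]]]]|
  _ [gs [s [-> Lgs IT]]]].
  by exists gs, s.
split; last by exists gs, s; split.
by apply: mother_glue => // t; case: (k) (Lgs t) => [|k'] [].
Qed.

Lemma Lset_sub k : Lset d k `<=` mother_group d.
Proof. by case: k => [|k] g []. Qed.

Lemma Lset_mulA k g s : Lset d k g -> Lset d k (g * rooted s).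
Proof.
case: k => [|k]; last first.
  rewrite LsetS => -[gs [r [-> Lgs IT]]].
  by rewrite glue_rooted; exists gs, (r * s).
move=> [Gg [gs [r [/wreath_glueP gE Lgs]]]]; split.
  by apply: motherM => //; exact: mother_rooted.
by exists gs, (r * s); rewrite gE glue_rooted; split=> //; exact/wreath_glueP.
Qed.

Lemma finite_Lset k : finite_set (Lset d k).
Proof.
have d_gt0 := ltn_trans (isT : 0 < 4) hd.
elim: k => [|k IHk]; last first.
  by rewrite LsetS; exact: finite_step.
(* An element of L_0 is coded by the parameters of its directed component, its rooted components and
   its first-level permutation. *)
pose AF := {ffun 'I_d -> alt_perm d}.
pose F (p : AF * alt_perm d * (AF * alt_perm d)) : altAut d :=
  glue (fun t => if val t == 0%N then directed p.1.1 p.1.2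
                 else rooted (p.2.1 t)) p.2.2.
apply: (@sub_finite_set _ _ (range F)); last exact/finite_image/finite_finset.
move=> g [_ [gs [s [/wreath_glueP -> Lgs]]]].
have [a [rho [_ bE]]] : B d (gs (Ordinal d_gt0)) by have := Lgs (Ordinal d_gt0).
have /choice[al alE] : forall t, exists al, val t != 0%N -> gs t = rooted al.
  move=> t; have := Lgs t; case: eqP => [_ _|_ [al _ <-]]; first by exists 1.
  by exists al.
exists ((finfun a, rho), (finfun al, s)) => //.
congr glue; apply/funext => t /=.
case: ifPn => [/eqP t0|t0]; last by rewrite ffunE alE.
have -> : t = Ordinal d_gt0 by exact: val_inj.
by rewrite bE; congr directed; apply/funext => u; rewrite ffunE.
Qed.

(** This makes every ratio strictly less than 1. The identity is interior in L_0; then an interior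
    point repeated in all components is interior one level up. *)
Lemma Int_Lset_nonempty k : Int S (Lset d k) !=set0.
Proof.
have d_gt0 := ltn_trans (isT : 0 < 4) hd.
elim: k => [|k [g Ig]]; last first.
  rewrite LsetS; exists (glue (fun=> g) 1).
  apply: (@Int_step _ _ d_gt0) => //; last by move=> _; case: Ig.
  by move=> ? ?; exact: Lset_mulA.
have B1 : B d 1.
  exists (fun=> 1), 1; split=> [t _|]; first by rewrite perm1.
  apply: altAut_ext; elim=> //= t w IHw; rewrite perm1; case: ifP => _.
    by congr cons.
  by have /(congr1 (fun h : altAut d => h w)) /= -> := rooted1 d.
have L01 : Lset d 0 1.
  split; first exact: mother1.
  exists (fun=> 1), 1; split=> [|t]; first by apply/wreath_glueP; rewrite glue1.
  by case: ifP => // _; exists 1; rewrite ?rooted1.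
exists 1; apply/IntP; split=> // _ [[s _ <-]|[a [r [r0 ->]]]].
  exact: Lset_mulA.
rewrite mul1g; split; first by apply: mother_B; exists a, r.
do 2!eexists; split; first exact/wreath_glueP/directed_glue.
by move=> t; case: ifP => /= t0; rewrite t0; [exists a, r|exists (a t)].
Qed.

End Lset.

(** * Convergence of the numerical recursion *)

Lemma decay_cvg0 (R : realType) (d : nat) (u : R^nat) :
  (forall k, 0 <= u k)%R -> (forall k, u k < 1)%R ->
  (forall k, 1 - u k <= (1 - u k.+1) * (1 - u k ^+ d))%R ->
  u @ \oo --> (0 : R)%R.
Proof.
move=> u0 u1 uS.
have uS' k : (u k.+1 <= u k)%R.
  rewrite -lerN2 -(lerD2l 1); apply: le_trans (uS k) _.
  by rewrite ler_piMr ?subr_ge0 ?(ltW (u1 _)) // gerBl exprn_ge0.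
have ucvg : cvgn u.
  apply: nonincreasing_is_cvgn; first exact/nonincreasing_seqP.
  by exists 0%R => _ [k _ <-].
set l : R := limn u.
have l0 : (0 <= l)%R by apply: limr_ge => //; exact: nearW.
have l1 : (l < 1)%R.
  apply: le_lt_trans (u1 0%N); apply: nonincreasing_cvgn_ge => //.
  exact/nonincreasing_seqP.
have uS1 : (fun k => u k.+1) @ \oo --> l by rewrite (cvg_shiftS u).
suff : l = 0%R by move=> <-.
have : (1 - l <= (1 - l) * (1 - l ^+ d))%R.
  have c1 : (fun k => 1 - u k : R)%R @ \oo --> (1 - l : R)%R.
    by apply: cvgB ucvg; exact: cvg_cst.
  have c2 : (fun k => (1 - u k.+1) * (1 - u k ^+ d) : R)%R @ \oo -->
      ((1 - l) * (1 - l ^+ d) : R)%R.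
    apply: cvgM; apply: cvgB => //; try exact: cvg_cst.
    exact: (@continuous_cvg _ R R _ _ u (fun x : R => x ^+ d)%R l
      (@exprn_continuous R d l) ucvg).
  rewrite -[leRHS](cvg_lim _ c2) // -[leLHS](cvg_lim _ c1) //.
  by apply: ler_lim; [exact: cvgP c1|exact: cvgP c2|exact: nearW].
(* Dividing by 1 - l > 0 leaves l^d <= 0. *)
rewrite -[leLHS]mulr1 ler_pM2l ?subr_gt0 // lerBrDr gerDl => ld.
have : (l ^+ d == 0)%R by rewrite eq_le ld exprn_ge0.
by rewrite expf_eq0 => /andP[_ /eqP].
Qed.


(** * Amenability from Folner sets *)

Lemma ultra_fmap (T V : Type) (f : T -> V) (F : set_system T) :
  UltraFilter F -> UltraFilter (f @ F).
Proof.
move=> UF; have PF : ProperFilter F by exact: ultra_proper.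
apply: Build_UltraFilter => H PH FH; apply/seteqP; split=> // X HX.
(* If the preimage of [X] were not in [F], its complement would be, and the proper filter [H] would
   contain both [X] and its complement. *)
have [//|FC] := in_ultra_setVsetC (f @^-1` X) UF.
have HC : H (~` X) by apply: FH.
exfalso; apply: (@filter_not_empty _ H PH).
by rewrite -(setICr X); exact: filterI.
Qed.

(* The mean of E is the limit, along an ultrafilter on the indices, of the
   proportion of the x in L k such that x^-1 lies in E; the inverse turns the
   right invariance of a Folner sequence into left invariance. *)
Lemma folner_amenable (R : realType) (gT : groupType) (S : set gT)
    (L : nat -> set gT) :
  folner_sequence R (generated S) S L -> amenable R (generated S).
Proof.
move=> [Lprop bcvg].
(* [U] refines the filter at infinity, so the Folner limit persists along [U]. *)
have [U [UU sU]] := ultraFilterLemma (@eventually_filter : ProperFilter \oo).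
have PU : ProperFilter U by exact: ultra_proper.
pose N k : R := (#|` fset_set (L k)|%:R)%R.
pose Linv k (E : set gT) := L k `&` [set x | E x^-1].
pose e E k : R := (#|` fset_set (Linv k E)|%:R / N k)%R.
have finL k : finite_set (L k) by have [] := Lprop k.
have finE k E : finite_set (Linv k E) by apply: sub_finite_set (finL k) => x [].
have N_gt0 k : (0 < N k)%R.
  rewrite ltr0n cardfs_gt0; have [_ _ [x Lx]] := Lprop k.
  by apply/fset0Pn; exists x; rewrite in_fset_set //; exact/mem_set.
have e_ge0 E k : (0 <= e E k)%R by rewrite divr_ge0.
have e_le1 E k : (e E k <= 1)%R.
  rewrite ler_pdivrMr // mul1r ler_nat.
  by apply: leq_card_fset_set_sub => // x [].
have eU E F k : E `&` F = set0 -> e (E `|` F) k = (e E k + e F k)%R.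
  move=> EF0; rewrite /e -mulrDl -natrD; congr (_%:R / _)%R.
  have -> : Linv k (E `|` F) = Linv k E `|` Linv k F.
    by rewrite /Linv -setIUr.
  rewrite fset_setU // cardfsU (_ : _ `&` _ = fset0)%fset ?cardfs0 ?subn0 //.
  rewrite -fset_setI // -fset_set0; congr fset_set.
  apply/seteqP; split=> // x [[_ Ex] [_ Fx]].
  by have : (E `&` F) x^-1 by []; rewrite EF0.
(* Proportions lie in the compact interval [0, 1], where every ultrafilter converges. *)
have ecvg E : e E @ U --> lim (e E @ U).
  have := @segment_compact R 0%R 1%R; rewrite compact_ultra => /(_ (e E @ U)).
  case=> [||x [_ xP]].
  - exact: ultra_fmap.
  - apply: (@filterE _ U _ (e E @^-1` _)) => k.
    by rewrite /= in_itv /= e_ge0 e_le1.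
  - exact: cvgP xP.
pose m E : R := lim (e E @ U).
(* Off the boundary, x -> x s injects the points counted for s E into those counted for E; the
   boundary proportion tends to 0. *)
have mM s E : S s -> (m [set (s * x)%g | x in E] <= m E)%R.
  move=> Ss; pose b k : R := (#|` fset_set (boundary S (L k))|%:R / N k)%R.
  have bU : b @ U --> (0 : R)%R by apply: cvg_trans bcvg; exact: cvg_app sU.
  have c : (fun k => e E k + b k)%R @ U --> (m E + 0)%R.
    by apply: cvgD => //; exact: ecvg.
  rewrite -[leRHS]addr0 -(cvg_lim _ c) //.
  apply: ler_lim; [exact: cvgP (ecvg _)|exact: cvgP c|apply: nearW => k].
  rewrite /e /b -mulrDl ler_pM2r ?invr_gt0 // -natrD ler_nat.
  set sE := Linv k _; have fsE : finite_set sE := finE _ _.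
  have fb : finite_set (boundary S (L k)).
    by apply: sub_finite_set (finL k) => x [].
  have -> : #|` fset_set sE| = (#|` fset_set (sE `\` boundary S (L k))|
      + #|` fset_set (sE `&` boundary S (L k))|)%N.
    rewrite -(cardfsID (fset_set (boundary S (L k))) (fset_set sE)) addnC.
    by rewrite -(fset_setD fsE fb) -(fset_setI fsE fb).
  apply: leq_add; last by apply: leq_card_fset_set_sub => // x [].
  have fD : finite_set (sE `\` boundary S (L k)).
    by apply: sub_finite_set fsE => x [].
  have <- : #|` fset_set ((fun x => x * s) @` (sE `\` boundary S (L k)))| =
      #|` fset_set (sE `\` boundary S (L k))|.
    by rewrite fset_set_image // card_imfset //; exact: mulIg.
  apply: leq_card_fset_set_sub => // _ [x [[Lx [y Ey xE]] nbx] <-].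
  have Lxs : L k (x * s).
    by apply: contrapT => nL; apply: nbx; split=> //; exists s.
  by split=> //=; rewrite invgM -xE mulKg.
have mU E F : E `&` F = set0 -> m (E `|` F) = (m E + m F)%R.
  move=> EF0; rewrite /m (_ : e (E `|` F) = (fun k => e E k + e F k)%R).
    by apply: cvg_lim => //; apply: cvgD; exact: ecvg.
  by apply/funext => k; exact: eU.
(* Stated so as to cover both the whole type, for complements, and the generated subgroup. *)
have m1 E : (forall k x, L k x -> E x^-1) -> m E = 1%R.
  move=> LE; rewrite /m (_ : e E = cst 1%R).
    by apply: cvg_lim => //; exact: cvg_cst.
  apply/funext => k; rewrite /e (_ : Linv k E = L k).
    by rewrite -/(N k) divff ?gt_eqF.
  by apply/seteqP; split=> [x []|x Lx] //; split=> //; exact: LE Lx.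
have mC E : (m E + m (~` E) = 1)%R.
  by rewrite -mU ?setICr // setUv m1.
(* Left translation commutes with complements, so [mM] applied to the complement gives the reverse
   inequality. *)
have mS s E : S s -> m [set s * x | x in E] = m E.
  move=> Ss; apply/eqP; rewrite eq_le mM //=.
  have := mM _ (~` E) Ss.
  have -> : [set s * x | x in ~` E] = ~` [set s * x | x in E].
    apply/seteqP; split=> [_ [x nEx <-] [y Ey /mulgI yx]|x nEx].
      by apply: nEx; rewrite -yx.
    exists (s^-1 * x); last by rewrite mulVKg.
    by move=> Ex; apply: nEx; exists (s^-1 * x) => //; rewrite mulVKg.
  have /(canRL (addKr _)) -> := mC E.
  have /(canRL (addKr _)) -> := mC [set s * x | x in E].
  by rewrite lerD2r lerN2.
have mG g E : generated S g -> m [set g * x | x in E] = m E.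
  move=> Gg; move: g Gg E; apply: smallest_sub => [|s Ss E]; last exact: mS.
  have mulE g h (E : set gT) :
      [set (g * h) * x | x in E] = [set g * x | x in [set h * x | x in E]].
    by rewrite image_comp; apply: eq_imagel => x _; rewrite /= mulgA.
  have one E : [set 1 * x | x in E] = E :> set gT.
    by rewrite -[RHS]image_id; apply: eq_imagel => x _; exact: mul1g.
  split=> [E|g h Hg Hh E|g Hg E]; first by rewrite one.
    by rewrite mulE Hg Hh.
  by rewrite -[LHS]Hg -mulE mulgV one.
exists m; split.
- move=> E _; apply: limr_ge; [exact: cvgP (ecvg E)|exact: nearW].
- apply: m1 => k x Lx; have [_ _] := generated_is_subgroup S; apply.
  by have [+ _ _] := Lprop k; apply.
- by move=> E F _ _; exact: mU.
- by move=> g E Gg _; exact: mG.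
Qed.

(** * From the counts to the recursion on boundary ratios *)

Theorem theorem3p3 (R : realType) (d : nat) (hd : (5 <= d)%N) :
  folner_sequence R (mother_group d) (A d `|` B d) (Lset d) /\
  amenable R (mother_group d).
Proof.
suff F : folner_sequence R (mother_group d) (A d `|` B d) (Lset d).
  by split=> //; exact: folner_amenable F.
have IntL k : Int (A d `|` B d) (Lset d k) `<=` Lset d k by move=> x [].
split=> [k|].
  split; [exact: Lset_sub|exact: finite_Lset|].
  by have [g /IntL Lg] := Int_Lset_nonempty hd k; exists g.
set u := (X in X @ \oo --> _).
have fL := @finite_Lset d hd.
have d_gt0 : 0 < d by exact: leq_trans hd.
pose n k := #|` fset_set (Lset d k)|.
pose b k := #|` fset_set (boundary (A d `|` B d) (Lset d k))|.
have b_lt k : b k < n k.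
  rewrite /b /n -(card_boundary_Int (A d `|` B d) (fL k)).
  rewrite -[ltnLHS]addn0 ltn_add2l.
  have [g Ig] := Int_Lset_nonempty hd k.
  rewrite cardfs_gt0; apply/fset0Pn; exists g.
  rewrite in_fset_set; first exact/mem_set.
  exact: sub_finite_set (@IntL k) (fL k).
have n_gt0 k : (0 < (n k)%:R :> R)%R.
  by rewrite ltr0n (leq_ltn_trans _ (b_lt k)).
apply: (@decay_cvg0 R d) => k.
- by rewrite divr_ge0.
- by rewrite ltr_pdivrMr; [rewrite mul1r ltr_nat; exact: b_lt|exact: n_gt0].
have LA := @Lset_mulA d hd k.
have nE := card_step (fL k); have bE := card_boundary_step d_gt0 LA (fL k).
rewrite -(LsetS hd) -/(n _) -/(b _) in nE bE.
have a_gt0 : (0 < #|alt_perm d|%:R :> R)%R.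
  by rewrite ltr0n; apply/card_gt0P; exists 1.
(* Ensures that the truncated subtraction in [card_step] becomes a true difference of reals. *)
have bn : (b k ^ d <= n k ^ d)%N by rewrite leq_exp2r // ltnW.
have nR : ((n k.+1)%:R =
    #|alt_perm d|%:R * ((n k)%:R ^+ d - (b k)%:R ^+ d) :> R)%R.
  by rewrite nE natrM natrB // !natrX.
have bR : ((b k.+1)%:R +
    #|alt_perm d|%:R * (((n k)%:R - (b k)%:R) * (n k)%:R ^+ d.-1)
    <= (n k.+1)%:R :> R)%R.
  by rewrite -natrB ?(ltnW (b_lt k)) // -natrX -!natrM -natrD ler_nat.
have p_gt0 := exprn_gt0 d.-1 (n_gt0 k).
have nd : ((n k)%:R ^+ d = (n k)%:R * (n k)%:R ^+ d.-1 :> R)%R.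
  by rewrite -exprS prednK.
have n'_gt0 := n_gt0 k.+1.
rewrite /u /= -/(n _) -/(b _) expr_div_n.
move: nR bR p_gt0 a_gt0 (n_gt0 k) n'_gt0; rewrite nd -/(n _) -/(b _).
move: (#|_|%:R)%R ((n k)%:R)%R ((b k)%:R)%R ((n k.+1)%:R)%R ((b k.+1)%:R)%R.
move=> a N M N' M'; move: (N ^+ _)%R (M ^+ _)%R => P Q.
move=> N'E M'_le P_gt0 a_gt0 N_gt0 N'_gt0.
(* The count [N'E] turns the second factor into N' / (a N P), so N' cancels; over the common
   denominator a N P the claim reduces to the linear bound [M'_le]. *)
have -> : ((1 - M' / N') * (1 - Q / (N * P)) = (N' - M') / (a * (N * P)))%R.
  have -> : (1 - Q / (N * P) = N' / (a * (N * P)))%R.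
    by rewrite N'E; field; rewrite !gt_eqF.
  by field; rewrite !gt_eqF.
have -> : (1 - M / N = (a * ((N - M) * P)) / (a * (N * P)))%R.
  by field; rewrite !gt_eqF.
by rewrite ler_pM2r ?invr_gt0 ?mulr_gt0 //; lra.
Qed.
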